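(* Let $G$ be a connected graph of order $n\ge 2$ and let $H$ be a non-trivial graph. If there exists a local adjacency basis $S$ for $H$ such that $S\not\subseteq N_H(v)$ for every $v\in V(H)\setminus S$, then $$\operatorname{dim}_{A,l}(G\odot H)=n\cdot \operatorname{dim}_{A,l}(H).$$
   Context: All graphs are finite, simple, undirected; non-trivial means order at least 2. A set $S\subseteq V(H)$ is a local adjacency generator for $H$ if for every two adjacent vertices $x,y\in V(H)\setminus S$ there exists $s\in S$ with $|N_H(s)\cap\{x,y\}|=1$ ($N_H$ the open neighbourhood); a local adjacency basis is a local adjacency generator of minimum cardinality, and this cardinality is $\operatorname{dim}_{A,l}(H)$. The corona product $G\odot H$ ($G$ of order $n$ with vertices $v_1,\dots,v_n$) consists of $G$ and $n$ disjoint copies $H_1,\dots,H_n$ of $H$, with $v_i$ joined to every vertex of $H_i$. *)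

(* Defs.v *)
From mathcomp Require Import all_boot.

Set Implicit Arguments.
Unset Strict Implicit.
Unset Printing Implicit Defensive.

Record sgraph := SGraph {
  vertex :> finType;
  adj : rel vertex;
  adj_sym : symmetric adj;
  adj_irrefl : irreflexive adj }.

Definition neighbors (G : sgraph) (v : G) : {set G} := [set w | adj v w].

(* The graph without vertices also satisfies this. *)
Definition connected_graph (G : sgraph) : Prop :=
  forall x y : G, connect (@adj G) x y.

Definition local_adj_generator (H : sgraph) (S : {set H}) : bool :=
  [forall x : H, forall y : H,
    [&& x \notin S, y \notin S & adj x y] ==>
    [exists s in S, #|neighbors s :&: [set x; y]| == 1]].

Definition local_adj_basis (H : sgraph) (S : {set H}) : bool :=
  local_adj_generator S &&
  [forall S' : {set H}, local_adj_generator S' ==> (#|S| <= #|S'|)].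

Lemma local_adj_generatorT (H : sgraph) : local_adj_generator [set: H].
Proof. by apply/forallP=> x; apply/forallP=> y; rewrite inE. Qed.

(* [set: H] only serves as a witness that local adjacency generators exist. *)
Definition local_adj_dim (H : sgraph) : nat :=
  #|[arg min_(S < [set: H] | local_adj_generator S) #|S|]|.

Lemma local_adj_basis_dim (H : sgraph) (S : {set H}) :
  local_adj_basis S -> #|S| = local_adj_dim H.
Proof.
rewrite /local_adj_dim => /andP[gS /forallP minS].
case: arg_minnP => [|B gB minB]; first exact: local_adj_generatorT.
by apply/eqP; rewrite eqn_leq minB // andbT (implyP (minS B)).
Qed.

(* inl v is the vertex v of G; inr (v, x) is the vertex x of the copy of H
   attached to v. *)
Definition corona_adj (G H : sgraph) : rel (G + G * H)%type :=
  fun a b => match a, b with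
  | inl u, inl v => adj u v
  | inl u, inr (v, _) => u == v
  | inr (u, _), inl v => u == v
  | inr (u, x), inr (v, y) => (u == v) && adj x y
  end.

Lemma corona_adj_sym (G H : sgraph) : symmetric (@corona_adj G H).
Proof.
by move=> [u|[u x]] [v|[v y]] //=; rewrite 1?eq_sym // adj_sym.
Qed.

Lemma corona_adj_irrefl (G H : sgraph) : irreflexive (@corona_adj G H).
Proof. by move=> [u|[u x]] /=; rewrite adj_irrefl // andbF. Qed.

Definition corona (G H : sgraph) : sgraph :=
  SGraph (@corona_adj_sym G H) (@corona_adj_irrefl G H).

(* Main.v *)
(** In the corona, two vertices of the same copy of [H] are told apart only by
    vertices of that copy, so a generator of the corona restricts to a generator
    of each copy: this is the lower bound. Conversely, the union of copies of [S]
    is a generator. The hypothesis on [S] separates [v] from the vertices of its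
    copy; it also makes [S] nonempty, which separates the vertices of [G]. *)

Require Import Defs.
From mathcomp Require Import all_boot.

(** As [x] and [y] are distinct, the intersection has size [adj s x + adj s y], a sum of two
    booleans, which is 1 exactly when they differ. *)
Lemma card_neighborsI2 (H : sgraph) (s x y : H) : x != y ->
  (#|neighbors s :&: [set x; y]| == 1) = (adj s x != adj s y).
Proof.
move=> nxy; rewrite setIUr cardsU !(setIC (neighbors s)).
have cardI1 z : #|[set z] :&: neighbors s| = adj s z.
  have [sz|nsz] := boolP (adj s z).
    by rewrite (setIidPl _) ?cards1 // sub1set inE.
  by apply: eq_card0 => w; rewrite !inE; apply: contraNF nsz => /andP[/eqP<-].
rewrite !cardI1 setIACA (_ : [set x] :&: [set y] = set0).
  by rewrite set0I cards0; do 2 case: (adj _ _).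
by apply/setP=> w; rewrite !inE; case: eqP => // ->; rewrite (negPf nxy).
Qed.

Lemma local_adj_generatorP (H : sgraph) (S : {set H}) :
  reflect (forall x y, x \notin S -> y \notin S -> adj x y ->
             exists2 s, s \in S & adj s x != adj s y)
          (local_adj_generator S).
Proof.
have neq_adj (x y : H) : adj x y -> x != y.
  by apply: contraTneq => ->; rewrite adj_irrefl.
apply: (iffP forallP) => gS x => [y Sx Sy xy|].
  have /implyP := forallP (gS x) y; rewrite Sx Sy xy => /(_ isT).
  case/exists_inP=> s sS; rewrite card_neighborsI2; last exact: neq_adj.
  by exists s.
apply/forallP=> y; apply/implyP=> /and3P[Sx Sy xy].
have [s sS sxy] := gS x y Sx Sy xy.
by apply/exists_inP; exists s; rewrite // card_neighborsI2 // neq_adj.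
Qed.

Lemma local_adj_dim_le (H : sgraph) (S : {set H}) :
  local_adj_generator S -> local_adj_dim H <= #|S|.
Proof.
rewrite /local_adj_dim; case: arg_minnP => [|B _ minB]; last exact: minB.
exact: local_adj_generatorT.
Qed.

Section CoronaGenerators.

Variables G H : sgraph.

Definition copy_trace (B : {set corona G H}) (v : G) : {set H} :=
  [set x | (inr (v, x) : corona G H) \in B].

Definition copies (S : {set H}) : {set corona G H} :=
  [set (inr p : corona G H) | p in setX [set: G] S].

Lemma mem_copies_inl (S : {set H}) (v : G) : (inl v \in copies S) = false.
Proof. by apply/imsetP=> -[]. Qed.

Lemma mem_copies_inr (S : {set H}) (v : G) (x : H) :
  (inr (v, x) \in copies S) = (x \in S).
Proof. by rewrite mem_imset ?inE // => p q []. Qed.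

Lemma card_copies (S : {set H}) : #|copies S| = #|G| * #|S|.
Proof. by rewrite card_imset ?cardsX ?cardsT // => p q []. Qed.

(** The traces correspond to disjoint parts of [B]. Equality can fail because [B] may also contain
    vertices of [G], which no trace counts. *)
Lemma sum_card_copy_trace (B : {set corona G H}) :
  \sum_v #|copy_trace B v| <= #|B|.
Proof.
have injr : injective (fun p => inr p : corona G H) by move=> p q [].
rewrite [X in X <= _](_ : _ = #|[set p | (inr p : corona G H) \in B]|).
  rewrite -(card_imset _ injr); apply/subset_leq_card/subsetP => b.
  by case/imsetP=> p; rewrite inE => pB ->.
rewrite -sum1dep_card.
rewrite (eq_bigr (fun v => \sum_(x | (inr (v, x) : corona G H) \in B) 1)).
  by rewrite pair_big_dep /=; apply: eq_bigl => -[].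
by move=> v _; rewrite -sum1_card; apply: eq_bigl => x; rewrite inE.
Qed.

Lemma copy_trace_generator (B : {set corona G H}) (v : G) :
  local_adj_generator B -> local_adj_generator (copy_trace B v).
Proof.
move/local_adj_generatorP=> gB; apply/local_adj_generatorP=> x y.
rewrite !inE => Bx By xy.
(* A separating vertex [inl u] is impossible: it is adjacent to both vertices or to neither,
   according to whether [u] is [v]. *)
have /= [|[u|[u z]] zB] := gB _ _ Bx By; first by rewrite eqxx.
  by rewrite eqxx.
by move=> /=; case: (eqVneq u v) zB => //= -> zB zxy; exists z; rewrite ?inE.
Qed.

Lemma copies_generator (S : {set H}) (x0 : H) :
  local_adj_generator S ->
  (forall x, x \notin S -> ~~ (S \subset neighbors x)) ->
  local_adj_generator (copies S).
Proof.
move=> /local_adj_generatorP gS nS.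
have [s0 s0S] : exists s, s \in S.
  (* An empty [S] would miss [x0] and yet lie in the neighbourhood of [x0], against [nS]. *)
  apply/set0Pn; apply: contraTneq isT => S0.
  by have := nS x0; rewrite S0 inE sub0set => /(_ isT).
have sep x : x \notin S -> exists2 s, s \in S & ~~ adj s x.
  by case/nS/subsetPn=> s sS; rewrite inE adj_sym; exists s.
apply/local_adj_generatorP=> -[u|[u x]] [v|[v y]];
  rewrite ?mem_copies_inl ?mem_copies_inr //=.
(* The only neighbour in [G] of a vertex in the copy at [u] is [u] itself, and [u] differs from
   [v]. *)
- move=> _ _ uv; exists (inr (u, s0)); rewrite ?mem_copies_inr //= eqxx.
  by case: (eqVneq u v) uv => // ->; rewrite adj_irrefl.
(* The vertex [v] is adjacent to its whole copy, so any [s] in [S] not adjacent to [y] separates the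
   two. *)
- move=> _ Sy /eqP->; have [s sS nsy] := sep y Sy.
  by exists (inr (v, s)); rewrite ?mem_copies_inr //= eqxx (negPf nsy).
- move=> Sx _ /eqP->; have [s sS nsx] := sep x Sx.
  by exists (inr (v, s)); rewrite ?mem_copies_inr //= eqxx (negPf nsx).
- move=> Sx Sy /andP[/eqP-> xy]; have [s sS sxy] := gS x y Sx Sy xy.
  by exists (inr (v, s)); rewrite ?mem_copies_inr //= eqxx.
Qed.

Lemma local_adj_dim_corona_ge :
  #|G| * local_adj_dim H <= local_adj_dim (corona G H).
Proof.
rewrite [X in _ <= X]/local_adj_dim; case: arg_minnP => [|B gB _].
  exact: local_adj_generatorT.
apply: leq_trans (sum_card_copy_trace B); rewrite -sum_nat_const.
by apply: leq_sum => v _; apply/local_adj_dim_le/copy_trace_generator.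
Qed.

End CoronaGenerators.

Theorem theorem20 (G H : sgraph) (n : nat)
  (Gn : #|G| = n) (n_ge2 : 2 <= n) (G_conn : connected_graph G)
  (H_nontriv : 2 <= #|H|)
  (H_basis : exists2 S : {set H}, local_adj_basis S &
     forall v : H, v \notin S -> ~~ (S \subset neighbors v)) :
  local_adj_dim (corona G H) = n * local_adj_dim H.
Proof.
have [S bS nS] := H_basis; have /andP[gS _] := bS.
have /card_gt0P[x0 _] : 0 < #|H| by apply: ltnW.
apply/eqP; rewrite -Gn eqn_leq local_adj_dim_corona_ge andbT.
(* Since [S] is a basis, the upper bound becomes the size of the generator [copies S]. *)
rewrite -(local_adj_basis_dim bS) -card_copies.
exact: local_adj_dim_le (copies_generator _ _ _ x0 gS nS).
Qed.
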